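(* Set $\Delta(\mu)=(\mu^2-3)(3\mu^4+1)$, $p(\mu)=3\mu^6-7\mu^4+3\mu^2-3$, $\beta_0(\mu)=2(\mu^2+1)$, $\beta_1(\mu)=2\mu(\mu^2+1)$, $\beta_2(\mu)=2\mu^2(\mu^2+1)$. For the quotient $\Gamma\backslash\mathcal T$ attached to the elliptic curve $X:y^2=x^3+x+1$ over $\mathbb F_3$, the Jacobi-normalized scattering matrix is $$S_X(\mu)=\frac1{\Delta(\mu)}\begin{pmatrix}p(\mu)/\mu^2&\beta_0(\mu)&\beta_1(\mu)&\beta_1(\mu)\\\beta_0(\mu)&p(\mu)/\mu^2&\beta_1(\mu)&\beta_1(\mu)\\\beta_1(\mu)&\beta_1(\mu)&\beta_2(\mu)&p(\mu)\\\beta_1(\mu)&\beta_1(\mu)&p(\mu)&\beta_2(\mu)\end{pmatrix},$$ and hence $$\det S_X(\mu)=-\frac{(3\mu^2-1)(\mu^4+3)}{\mu^4(\mu^2-3)(3\mu^4+1)} .$$ The classical constant-term matrix and the Efrat-holomorphic coefficient matrix are $$\mathcal S_{\mathrm{aut},X}(s)=D_0^{-1}S_X(\mu)D_0,\qquad \Phi_X(s)=\frac{c_{\mathrm{in}}(\mu)}{c_{\mathrm{out}}(\mu)}D_0^{-1}S_X(\mu)D_0,\qquad D_0=\operatorname{diag}(1,1,\sqrt3,\sqrt3),$$ where $\mu=3^{s-1/2}$.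
   Context: Let $q=3$, $a=\sqrt3$. Let $X:y^2=x^3+x+1$ over $\mathbb F_3$ with point at infinity $O$, $\mathcal A_X=\mathbb F_3[x,y]/(y^2-x^3-x-1)$, $\Gamma=\mathrm{PGL}_2(\mathcal A_X)$ (image of $\mathrm{GL}_2(\mathcal A_X)$ in $\mathrm{PGL}_2(\mathbb F_3(X))$), acting on the $4$-regular Bruhat–Tits tree $\mathcal T$ at $O$. For a quotient vertex $v$ put $\lambda(v)=|\Gamma_v|^{-1}$ ($\Gamma_v$ the stabilizer of a lift). The adjacency operator is $(Af)(v)=\sum_e[\Gamma_v:\Gamma_e]f(t(e))$, the sum over $\Gamma_v$-orbits of oriented edges issuing from a lift of $v$, $\Gamma_e$ the stabilizer of $e$ in $\Gamma_v$, $t(e)$ the terminal quotient vertex. From Takahashi's fundamental domain, the quotient consists of a finite core $v_1,\dots,v_9$ and four cusp rays with vertices $(c_j,n)$, $n\ge1$. Core vertex stabilizer orders for $v_1,\dots,v_9$: $6,24,3,1,4,2,3,6,24$. Core edges with stabilizer orders: $v_1v_2:6$, $v_1v_3:3$, $v_3v_4:1$, $v_4v_5:1$, $v_4v_6:1$, $v_4v_7:1$, $v_7v_8:3$, $v_8v_9:6$. The cusps $c_1,c_2,c_3,c_4$ are attached respectively at $v_1,v_8,v_6,v_6$, with attachment-edge stabilizer orders $6,6,2,2$ and first-vertex $(c_j,1)$ stabilizer orders $18,18,6,6$; along the rays $(Af)(c_j,n)=3f(c_j,n-1)+f(c_j,n+1)$ for $n\ge2$. With $\lambda(c_j,n)=w_j(q+1)q^{-n}$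 the cusp widths give $W=\frac1{24}\operatorname{diag}(1,1,3,3)$. With $Uf=\lambda^{1/2}f$, $J=UAU^{-1}$ acts on $\mathbb C^9\oplus\bigoplus_{j=1}^4\ell^2(\mathbb N)$ as $J(u,g)=(H_Cu+Vg(1),h)$, $h(1)=ag(2)+V^*u$, $h(n)=a\{g(n-1)+g(n+1)\}$ ($n\ge2$), where $H_C$ is the real symmetric $9\times9$ matrix with nonzero entries (up to symmetry) $h_{12}=2$, $h_{13}=\sqrt2$, $h_{34}=\sqrt3$, $h_{45}=2$, $h_{46}=\sqrt2$, $h_{47}=\sqrt3$, $h_{78}=\sqrt2$, $h_{89}=2$, and $V=\sqrt3\,(e_1\ e_8\ e_6\ e_6)$ ($e_i$ standard vectors of $\mathbb C^9$). Put $$F_X(\mu)=H_C-\sqrt3(\mu+\mu^{-1})I_9+\frac{\mu^{-1}}{\sqrt3}VV^*,\qquad S_X(\mu)=-I_4+\frac{\mu^{-1}-\mu}{\sqrt3}V^*F_X(\mu)^{-1}V$$ (the Jacobi-normalized scattering matrix; identities are of meromorphic functions of $\mu$). Automorphic normalizations: let $\mu=q^{s-1/2}$, $c_{\mathrm{in}}(\mu)=\frac\mu a-a\mu^{-1}$, $c_{\mathrm{out}}(\mu)=a\mu-\frac{\mu^{-1}}a$. For $b\in\mathbb C^4$, the generalized eigenfunction of $A$ with eigenvalue $q^s+q^{1-s}$ and incoming cusp term $q^{ns}b_c$ has cusp expansion $q^{ns}b_c+q^{n(1-s)}(\mathcal S_{\mathrm{aut},X}(s)b)_c$, defining $\mathcal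 S_{\mathrm{aut},X}(s)$; the generalized eigenfunction with incoming term $b_cq^{ns}(q^{s-1}-q^{1-s})$ has cusp expansion $b_cq^{ns}(q^{s-1}-q^{1-s})+(\Phi_X(s)b)_cq^{n(1-s)}(q^s-q^{-s})$, defining $\Phi_X(s)$ (all continued meromorphically). *)

(* Defs.v *)
From HB Require Import structures.
From mathcomp Require Import all_boot all_order all_algebra.
From mathcomp Require Import finmap.
From mathcomp Require Import all_classical all_reals all_analysis.
From mathcomp Require Import complex.
From mathcomp Require Import zify ring.

Set Implicit Arguments.
Unset Strict Implicit.
Unset Printing Implicit Defensive.

Import Order.TTheory GRing.Theory Num.Theory.
Import Pdiv.CommonRing Pdiv.RingMonic.

Local Open Scope classical_set_scope.
Local Open Scope ring_scope.

Definition cubic : {poly 'F_3} := 'X^3 + 'X + 1.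

Definition weierstrass : {poly {poly 'F_3}} := 'X^2 - cubic%:P.

Definition AX := {poly %/ weierstrass}.

HB.instance Definition _ := GRing.ComNzRing.on AX.

Definition x_AX : AX := qpolyC weierstrass 'X.
Definition y_AX : AX := in_qpoly weierstrass 'X.

Lemma size_cubic : size cubic = 4%N.
Proof.
rewrite /cubic -addrA size_polyDl size_polyXn //.
by rewrite size_polyDl ?size_polyX ?size_poly1.
Qed.

Lemma size_weierstrass : size weierstrass = 3%N.
Proof.
by rewrite /weierstrass size_polyDl size_polyXn // size_polyN (leq_ltn_trans (size_polyC_leq1 _)).
Qed.

Lemma monic_weierstrass : weierstrass \is monic.
Proof.
rewrite monicE lead_coefE size_weierstrass /weierstrass coefB coefXn coefC /=.
by rewrite subr0.
Qed.

Lemma mk_monic_weierstrass : mk_monic weierstrass = weierstrass.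
Proof. by rewrite /mk_monic size_weierstrass monic_weierstrass. Qed.

Lemma size_AX (u : AX) : (size (u : {poly {poly 'F_3}}) <= 2)%N.
Proof.
have h : size (mk_monic weierstrass) = 3%N.
  by rewrite mk_monic_weierstrass size_weierstrass.
by rewrite -ltnS -[X in (_ < X)%N]h; exact: size_mk_monic.
Qed.

Lemma norm_AX_eq0 (f g : {poly 'F_3}) : f ^+ 2 = g ^+ 2 * cubic -> g = 0.
Proof.
move=> e; apply/eqP; apply: contraT => g0.
have c0 : cubic != 0 by rewrite -size_poly_eq0 size_cubic.
have f0 : f != 0.
  by rewrite -sqrf_eq0 e mulf_neq0 // sqrf_eq0.
have := congr1 (fun p : {poly 'F_3} => odd (size p)) e.
rewrite !expr2 !size_mul ?mulf_neq0 // size_cubic.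
move: f0 g0; rewrite -!size_poly_gt0.
by case: (size f) => // m _; case: (size g) => // n _; rewrite !addnS /= !oddD !addbb.
Qed.

Lemma rmodp_weierstrass_eq0 (U V : {poly {poly 'F_3}}) :
  (size U <= 2)%N -> (size V <= 2)%N ->
  rmodp (U * V) weierstrass = 0 -> (U == 0) || (V == 0).
Proof.
move=> sU sV /eqP; rewrite -/(rdvdp _ _).
move=> /(rdvdpP monic_weierstrass)[q eq_q].
rewrite -mulf_eq0; apply/eqP; rewrite eq_q.
have [->|q0] := eqVneq q 0; first by rewrite mul0r.
have sq : (size q <= 1)%N.
  have : U * V != 0 by rewrite eq_q mulf_neq0 // monic_neq0 // monic_weierstrass.
  rewrite mulf_eq0 negb_or => /andP[U0 V0].
  have := congr1 (fun p : {poly {poly 'F_3}} => size p) eq_q.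
  rewrite size_mul // size_Mmonic ?monic_weierstrass // size_weierstrass.
  move: sU sV; move: (size U) (size V) (size q) => m n k; lia.
have co (W : {poly {poly 'F_3}}) : (size W <= 2)%N ->
    W = (W`_0)%:P + (W`_1)%:P * 'X.
  move=> sW; apply/polyP => -[|[|i]].
  - by rewrite coefD coefC coefMX /= addr0.
  - by rewrite coefD coefC coefMX coefC /= add0r.
  - rewrite coefD coefC coefMX coefC /= add0r nth_default //.
    by rewrite (leq_trans sW).
rewrite (co U sU) (co V sV) (size1_polyC sq) in eq_q *.
set a := U`_0 in eq_q *; set b := U`_1 in eq_q *.
set a' := V`_0 in eq_q *; set b' := V`_1 in eq_q *; set c := q`_0 in eq_q *.
have e : (a%:P + b%:P * 'X) * (a'%:P + b'%:P * 'X) =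
   (a * a')%:P + (a * b' + b * a')%:P * 'X + (b * b')%:P * 'X^2
     :> {poly {poly 'F_3}}.
  by rewrite !polyCD !polyCM; ring.
rewrite e /weierstrass mulrBr -polyCM in eq_q.
have e0 := congr1 (fun p : {poly {poly 'F_3}} => p`_0) eq_q.
have e1 := congr1 (fun p : {poly {poly 'F_3}} => p`_1) eq_q.
have e2 := congr1 (fun p : {poly {poly 'F_3}} => p`_2) eq_q.
move: e0 e1 e2; rewrite !(coefB, coefD, coefC, coefMX, coefCM, coefXn) /=.
rewrite ?(mulr0, mulr1, addr0, add0r, subr0, sub0r) => e0 e1 e2.
have key : b' * (a ^+ 2 - b ^+ 2 * cubic) = 0.
  have -> : b' * (a ^+ 2 - b ^+ 2 * cubic) =
     a * (a * b' + b * a') - b * (a * a' + b * b' * cubic) by ring.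
  by rewrite e1 e0 e2; ring.
suff -> : c = 0 by rewrite mul0r.
rewrite -e2; move/eqP: key; rewrite mulf_eq0 subr_eq0.
move=> /orP[/eqP ->|/eqP n0]; first by rewrite mulr0.
by rewrite (norm_AX_eq0 n0) mul0r.
Qed.

Lemma mulf_eq0_AX (u v : AX) : u * v = 0 -> (u == 0) || (v == 0).
Proof.
move=> /(congr1 val) uv0.
apply: (@rmodp_weierstrass_eq0 (val u) (val v)); rewrite ?size_AX //.
by rewrite -[X in rmodp _ X]mk_monic_weierstrass.
Qed.

Definition unit_AX : pred AX := fun u => `[< exists v, v * u = 1 >].
Definition inv_AX (u : AX) : AX :=
  if unit_AX u then xget u [set v | v * u = 1] else u.

Lemma mulVr_AX : {in unit_AX, left_inverse 1 inv_AX *%R}.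
Proof.
move=> u uu; have {}uu : unit_AX u := uu.
rewrite /inv_AX uu; move/asboolP: uu => uu.
exact: (@xgetPex _ u [set v | v * u = 1]).
Qed.

Lemma unitP_AX (u v : AX) : v * u = 1 -> unit_AX u.
Proof. by move=> vu; apply/asboolP; exists v. Qed.

Lemma invr_out_AX : {in [predC unit_AX], inv_AX =1 id}.
Proof.
move=> u uu; have /negPf {}uu : ~~ unit_AX u := uu.
by rewrite /inv_AX uu.
Qed.

HB.instance Definition _ :=
  GRing.ComNzRing_hasMulInverse.Build AX mulVr_AX unitP_AX invr_out_AX.
HB.instance Definition _ :=
  GRing.ComUnitRing_isIntegral.Build AX mulf_eq0_AX.

Definition KX := {fraction AX}.

(* An element of AX is uniquely u`_0 + u`_1 * y with u`_0, u`_1 in F_3[x]; x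
   and y have poles of order 2 and 3 at O, so the two summands have poles of
   different orders.  [pole_order 0] is the harmless value 0. *)
Definition pole_order (u : AX) : nat :=
  let f := u`_0 in let g := u`_1 in
  maxn (2 * (size f).-1) (if g == 0 then 0%N else (2 * (size g).-1 + 3)%N).

Definition local_ring : set KX :=
  [set z | exists u w : AX,
     [/\ w != 0, (pole_order u <= pole_order w)%N & z = tofrac u / tofrac w]].

Definition uniformizer : KX := tofrac x_AX / tofrac y_AX.

Notation K2 := 'cV[KX]_2.

(* Lattices over the local ring in F_3(X)^2, without completing: the homothety
   classes are in bijection with those over the completion at O. *)
Definition std_lattice : set K2 := [set w | forall i, local_ring (w i 0)].

Definition is_lattice (L : set K2) : Prop :=
  exists2 g : 'M[KX]_2, g \in unitmx & L = mulmx g @` std_lattice.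

Definition homothetic (c : KX) (L : set K2) : set K2 := [set c *: w | w in L].

Definition lattice_class (L : set K2) : set (set K2) :=
  [set homothetic c L | c in [set c | c != 0]].

Definition is_vertex (v : set (set K2)) : Prop :=
  exists2 L, is_lattice L & v = lattice_class L.

Definition adjacent (v w : set (set K2)) : Prop :=
  exists L L', [/\ v L, w L', homothetic uniformizer L `<` L' & L' `<` L].

Definition pgl_class (g : 'M[KX]_2) : set 'M[KX]_2 :=
  [set c *: g | c in [set c | c != 0]].

Definition Gamma : set (set 'M[KX]_2) :=
  [set pgl_class (map_mx (@tofrac AX) g) | g in [set g : 'M[AX]_2 | g \in unitmx]].

Definition act (P : set 'M[KX]_2) (v : set (set K2)) : set (set K2) :=
  [set L' | exists2 g, P g & exists2 L, v L & L' = mulmx g @` L].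

Definition stab (v : set (set K2)) : set (set 'M[KX]_2) :=
  [set P | Gamma P /\ act P v = v].

Definition edge_stab (v w : set (set K2)) : set (set 'M[KX]_2) :=
  [set P | stab v P /\ act P w = w].

(* An oriented edge issuing from v is given by its terminal vertex. *)
Definition edge_orbits (v : set (set K2)) : set (set (set (set K2))) :=
  [set [set act P w | P in stab v] | w in [set w | is_vertex w /\ adjacent v w]].

(* [fset_set] of an infinite set is empty; [lift_stab] below makes every vertex
   stabilizer finite. *)
Definition stab_index (v w : set (set K2)) : nat :=
  (#|` fset_set (stab v)| %/ #|` fset_set (edge_stab v w)|)%N.

(* A function on the quotient vertices is a [Gamma]-invariant function on the
   vertices of the tree. *)
Definition Gamma_invariant (T : Type) (f : set (set K2) -> T) : Prop :=
  forall P v, Gamma P -> is_vertex v -> f (act P v) = f v.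

Definition adjacency (V : nmodType) (f : set (set K2) -> V) (v : set (set K2)) : V :=
  \sum_(E \in edge_orbits v)
    let w := xget v E in f w *+ stab_index v w.

(* [inl i] is the core vertex v_(i+1), and [inr (j, n)] is the cusp vertex
   (c_(j+1), n+1). *)
Definition qvertex := ('I_9 + 'I_4 * nat)%type.

Definition core_order (i : 'I_9) : nat := nth 0%N [:: 6; 24; 3; 1; 4; 2; 3; 6; 24]%N i.

Definition cusp_order (j : 'I_4) : nat := nth 0%N [:: 18; 18; 6; 6]%N j.

(* 1-based index of the core vertex to which a cusp is attached *)
Definition attach_vertex (j : 'I_4) : nat := nth 0%N [:: 1; 8; 6; 6]%N j.

Definition attach_order (j : 'I_4) : nat := nth 0%N [:: 6; 6; 2; 2]%N j.

(* the order of the stabilizer of (c_j, m) is 1 / lambda = 3^m / (4 w_j) *)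
Definition vertex_order (u : qvertex) : nat :=
  match u with
  | inl i => core_order i
  | inr (j, n) => cusp_order j * 3 ^ n
  end%N.

(* 1-based indices *)
Definition core_edge (i k : nat) : nat :=
  match i, k with
  | 1, 2 => 6 | 1, 3 => 3 | 3, 4 => 1 | 4, 5 => 1
  | 4, 6 => 1 | 4, 7 => 1 | 7, 8 => 3 | 8, 9 => 6
  | _, _ => 0
  end%N.

(* Stabilizer order of the quotient edge between two quotient vertices, 0 if
   there is none.  Along a cusp ray, the stabilizer of the edge between (c, m)
   and (c, m+1) is that of (c, m): this gives the coefficients 3 and 1 of A. *)
Definition edge_order (u u' : qvertex) : nat :=
  match u, u' with
  | inl i, inl k => core_edge i.+1 k.+1 + core_edge k.+1 i.+1
  | inl i, inr (j, n) | inr (j, n), inl i =>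
      if (i.+1 == attach_vertex j) && (n == 0) then attach_order j else 0
  | inr (j, n), inr (k, m) =>
      if j != k then 0
      else if m == n.+1 then vertex_order u
      else if n == m.+1 then vertex_order u'
      else 0
  end%N.

(* [lift] labels the quotient of the tree by [Gamma]: it chooses a lift of every
   quotient vertex in such a way that the vertices, the edges and their
   stabilizer orders are those of the fundamental domain found by Takahashi. *)
Record takahashi_domain (lift : qvertex -> set (set K2)) : Prop := {
  lift_vertex : forall u, is_vertex (lift u);
  lift_cover : forall v, is_vertex v -> exists P u, Gamma P /\ v = act P (lift u);
  lift_inj : forall P u u', Gamma P -> act P (lift u) = lift u' -> u = u';
  lift_stab : forall u, (stab (lift u) #= `I_(vertex_order u))%card;
  (* The oriented edges from [lift u] ending in the orbit of [lift u'] form no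
     [stab (lift u)]-orbit, or exactly one. *)
  lift_no_edge : forall u u' P, edge_order u u' = 0%N -> Gamma P ->
    ~ adjacent (lift u) (act P (lift u'));
  lift_edge : forall u u', edge_order u u' != 0%N ->
    exists2 P, Gamma P &
    [/\ adjacent (lift u) (act P (lift u')),
        (edge_stab (lift u) (act P (lift u')) #= `I_(edge_order u u'))%card &
        forall Q, Gamma Q -> adjacent (lift u) (act Q (lift u')) ->
          exists2 S, stab (lift u) S & act Q (lift u') = act S (act P (lift u'))]
}.

Section Scattering.
Variable R : realType.
Local Notation C := R[i].

Definition sqrt3 : C := sqrtC 3.

(* upper triangular entries, 1-based *)
Definition core_entry (i k : nat) : C :=
  match i, k with
  | 1, 2 => 2        | 1, 3 => sqrtC 2 | 3, 4 => sqrtC 3 | 4, 5 => 2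
  | 4, 6 => sqrtC 2  | 4, 7 => sqrtC 3 | 7, 8 => sqrtC 2 | 8, 9 => 2
  | _, _ => 0
  end.

Definition HC : 'M[C]_9 :=
  \matrix_(i, k) (core_entry i.+1 k.+1 + core_entry k.+1 i.+1).

Definition Vmx : 'M[C]_(9, 4) :=
  sqrt3 *: \matrix_(i, j) (i.+1 == attach_vertex j)%:R.

Definition adjoint (m n : nat) (M : 'M[C]_(m, n)) : 'M[C]_(n, m) :=
  (map_mx Num.conj M)^T.

Definition FX (mu : C) : 'M[C]_9 :=
  HC - (sqrt3 * (mu + mu^-1))%:M + (mu^-1 / sqrt3) *: (Vmx *m adjoint Vmx).

(* meaningful for mu != 0 and [FX mu] invertible *)
Definition SX (mu : C) : 'M[C]_4 :=
  - 1%:M + ((mu^-1 - mu) / sqrt3) *: (adjoint Vmx *m invmx (FX mu) *m Vmx).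

Definition Delta (mu : C) : C := (mu ^+ 2 - 3) * (3 * mu ^+ 4 + 1).
Definition p_X (mu : C) : C := 3 * mu ^+ 6 - 7 * mu ^+ 4 + 3 * mu ^+ 2 - 3.
Definition beta0 (mu : C) : C := 2 * (mu ^+ 2 + 1).
Definition beta1 (mu : C) : C := 2 * mu * (mu ^+ 2 + 1).
Definition beta2 (mu : C) : C := 2 * mu ^+ 2 * (mu ^+ 2 + 1).

Definition mx_of_rows (m n : nat) (rows : seq (seq C)) : 'M[C]_(m, n) :=
  \matrix_(i, j) nth 0 (nth [::] rows i) j.

Definition D0 : 'M[C]_4 := diag_mx (\row_j nth 0 [:: 1; 1; sqrt3; sqrt3] j).

Definition expC (z : C) : C :=
  (expR (complex.Re z))%:C%C *
  Complex (cos (complex.Im z)) (sin (complex.Im z)).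

(* q ^ z for q = 3 *)
Definition qpow (z : C) : C := expC (z * (ln (3 : R))%:C%C).

Definition mu_of (s : C) : C := qpow (s - 2^-1).

Definition c_in (mu : C) : C := mu / sqrt3 - sqrt3 * mu^-1.
Definition c_out (mu : C) : C := sqrt3 * mu - mu^-1 / sqrt3.

Definition generalized_eigenfunction (lift : qvertex -> set (set K2))
    (s : C) (b b' : 'cV[C]_4) (f : set (set K2) -> C) : Prop :=
  [/\ Gamma_invariant f,
      forall v, is_vertex v -> adjacency f v = (qpow s + qpow (1 - s)) * f v &
      forall (j : 'I_4) (n : nat),
        f (lift (inr (j, n))) =
          qpow (n.+1%:R * s) * b j 0 + qpow (n.+1%:R * (1 - s)) * b' j 0].

(* M is the matrix sending the incoming cusp coefficients to the outgoing ones: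
   for every b there is a generalized eigenfunction with incoming term b, and
   its outgoing term is determined by b. *)
Definition is_Saut lift (s : C) (M : 'M[C]_4) : Prop :=
  forall b b' : 'cV[C]_4,
    (exists f, generalized_eigenfunction lift s b b' f) <-> b' = M *m b.

Definition is_Phi lift (s : C) (M : 'M[C]_4) : Prop :=
  forall b d : 'cV[C]_4,
    (exists f, generalized_eigenfunction lift s
       ((qpow (s - 1) - qpow (1 - s)) *: b)
       ((qpow s - qpow (- s)) *: d) f) <-> d = M *m b.

End Scattering.

(* Main.v *)
Require Import Defs.
From mathcomp Require Import all_boot all_order all_algebra.
From mathcomp Require Import finmap.
From mathcomp Require Import all_classical all_reals all_analysis.
From mathcomp Require Import complex ring.

(* The combinatorial data of the fundamental domain turn a Gamma-invariant
   eigenfunction on the tree into a function on the quotient satisfying finitely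
   many core equations, one attachment equation per cusp, and the three-term
   recurrence along the cusps.  The prescribed powers solve the recurrence, so
   that, extending the expansion formally to n = 0, the attachment equation says
   b_j + b'_j = f(attachment vertex).  Multiplying by lambda^(1/2), which is
   (6 * 3^n)^(-1/2) D_0 at height n of the cusps, turns the core equations into
   F_X u = (mu^-1 - mu) V D_0 b and the attachment equations into
   V^* u = sqrt 3 D_0 (b + b'); when F_X is invertible, eliminating u leaves
   D_0 b' = S_X D_0 b.  The system F_X u = V beta is solved explicitly. *)

Import Order.TTheory GRing.Theory Num.Theory.

Local Open Scope classical_set_scope.
Local Open Scope ring_scope.

(** * The action of Gamma on the tree *)

Section GroupAction.
Local Notation M2 := 'M[KX]_2.
Local Notation lattice := (set 'cV[KX]_2).
Implicit Types (g h k : M2) (L : lattice) (v w : set lattice).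

(** Matrix representatives of [Gamma]. Elements of [Gamma] are bare sets of matrices, so products
    and inverses are taken on representatives. *)
Definition gamma_mx : set M2 :=
  [set map_mx (@tofrac AX) g | g in [set g : 'M[AX]_2 | g \in unitmx]].

(* The action of a representative; it agrees with [act] on the classes stable
   under homothety. *)
Definition mx_act g v : set lattice := [set mulmx g @` L | L in v].

Definition mx_stab v : set M2 := [set h | gamma_mx h /\ mx_act h v = v].

Definition conj_class g (P : set M2) : set M2 := [set g *m h *m invmx g | h in P].

Lemma gamma_mx1 : gamma_mx 1%:M.
Proof. by exists 1%:M => /=; rewrite ?unitmx1 // map_mx1. Qed.

Lemma gamma_mxM g h : gamma_mx g -> gamma_mx h -> gamma_mx (g *m h).
Proof.
move=> [g' ug <-] [h' uh <-]; exists (g' *m h'); last exact: map_mxM.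
by rewrite /= unitmx_mul ug uh.
Qed.

Lemma gamma_mx_unit g : gamma_mx g -> g \in unitmx.
Proof.
move=> [g' ug <-]; have e : map_mx (@tofrac AX) g' *m map_mx (@tofrac AX) (invmx g') = 1%:M.
  by rewrite -map_mxM mulmxV // map_mx1.
exact: (mulmx1_unit e).1.
Qed.

Lemma gamma_mxV g : gamma_mx g -> gamma_mx (invmx g).
Proof.
move=> gg; have ug := gamma_mx_unit g gg; case: gg ug => g' ug <- ug'.
exists (invmx g'); first by rewrite /= unitmx_inv.
by rewrite -[LHS](mulKmx ug') -map_mxM mulmxV // map_mx1 mulmx1.
Qed.

Lemma GammaE P : Gamma P <-> exists2 g, gamma_mx g & P = pgl_class g.
Proof.
by split=> [[g ug <-]|[_ [g ug <-] ->]]; [exists (map_mx (@tofrac AX) g) => //; exists g|exists g].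
Qed.

Lemma mx_act1 v : mx_act 1%:M v = v.
Proof.
have e L : mulmx 1%:M @` L = L.
  by rewrite -[RHS]image_id; apply: eq_imagel => x _; rewrite mul1mx.
by rewrite -[RHS]image_id; apply: eq_imagel => L _; rewrite e.
Qed.

Lemma mx_actM g h v : mx_act (g *m h) v = mx_act g (mx_act h v).
Proof.
rewrite /mx_act image_comp; apply: eq_imagel => L _.
by rewrite /= image_comp; apply: eq_imagel => x _; rewrite /= mulmxA.
Qed.

Lemma mx_actK g : g \in unitmx -> cancel (mx_act g) (mx_act (invmx g)).
Proof. by move=> ug v; rewrite -mx_actM mulVmx // mx_act1. Qed.

Lemma mx_actKV g : g \in unitmx -> cancel (mx_act (invmx g)) (mx_act g).
Proof. by move=> ug v; rewrite -mx_actM mulmxV // mx_act1. Qed.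

Lemma image_homothetic g c L :
  mulmx g @` homothetic c L = homothetic c (mulmx g @` L).
Proof.
rewrite /homothetic !image_comp; apply: eq_imagel => x _ /=.
by rewrite scalemxAr.
Qed.

Lemma mx_act_lattice_class g L :
  mx_act g (lattice_class L) = lattice_class (mulmx g @` L).
Proof.
rewrite /mx_act /lattice_class image_comp; apply: eq_imagel => c _ /=.
exact: image_homothetic.
Qed.

Lemma mx_act_vertex g v : g \in unitmx -> is_vertex v -> is_vertex (mx_act g v).
Proof.
move=> ug [L [h uh ->] ->]; rewrite mx_act_lattice_class.
exists (mulmx g @` (mulmx h @` std_lattice)) => //; exists (g *m h).
  by rewrite unitmx_mul ug.
by rewrite image_comp; apply: eq_imagel => x _ /=; rewrite mulmxA.
Qed.

(** A vertex is stable under homothety, so every multiple [c *: g] acts on it as [g] does; on an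
    arbitrary set of lattices this can fail. *)
Lemma actE g v : is_vertex v -> act (pgl_class g) v = mx_act g v.
Proof.
move=> [L _ ->]; rewrite mx_act_lattice_class; apply/seteqP; split.
  move=> _ [_ [c c0 <-] [_ [d d0 <-] ->]].
  exists (c * d); first exact: (mulf_neq0 c0 d0).
  rewrite image_homothetic /homothetic !image_comp; apply: eq_imagel => x _ /=.
  by rewrite -scalemxAl scalerA mulrC.
move=> _ [d d0 <-]; exists g; first by exists 1; [exact: oner_neq0 | rewrite scale1r].
by exists (homothetic d L); [exists d|rewrite image_homothetic].
Qed.

Lemma mulmx_image_proper g L L' : g \in unitmx ->
  L `<` L' -> mulmx g @` L `<` mulmx g @` L'.
Proof.
move=> ug; rewrite !properEneq => -[LL' sLL']; split; last exact: image_subset.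
apply: contra_neq LL' => /(congr1 (fun X => mulmx (invmx g) @` X)).
have e N : mulmx (invmx g) @` (mulmx g @` N) = N.
  by rewrite image_comp -[RHS]image_id; apply: eq_imagel => x _; rewrite /= mulKmx.
by rewrite !e.
Qed.

Lemma mx_act_adjacent g v w : g \in unitmx ->
  Defs.adjacent v w -> Defs.adjacent (mx_act g v) (mx_act g w).
Proof.
move=> ug [L [L' [vL wL' h h']]].
exists (mulmx g @` L), (mulmx g @` L'); split; [by exists L|by exists L'| |].
  by rewrite -image_homothetic; exact: mulmx_image_proper.
exact: mulmx_image_proper.
Qed.

Lemma conj_class_pgl g h : conj_class g (pgl_class h) = pgl_class (g *m h *m invmx g).
Proof.
rewrite /conj_class /pgl_class image_comp; apply: eq_imagel => c _ /=.
by rewrite -scalemxAr -scalemxAl.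
Qed.

Lemma conj_classK g : g \in unitmx -> cancel (conj_class g) (conj_class (invmx g)).
Proof.
move=> ug P; rewrite /conj_class image_comp -[RHS]image_id; apply: eq_imagel => h _ /=.
by rewrite invmxK !mulmxA (mulVmx ug) mul1mx (mulmxKV ug).
Qed.

Lemma conj_class_inj g : g \in unitmx -> injective (conj_class g).
Proof. by move=> ug; exact: (can_inj (conj_classK g ug)). Qed.

Lemma stabE v P : is_vertex v ->
  stab v P <-> exists2 h, mx_stab v h & P = pgl_class h.
Proof.
move=> vv; split=> [[/GammaE[h gh ->] e]|[h [gh e] ->]].
  by exists h => //; split=> //; rewrite -actE.
by split; [apply/GammaE; exists h|rewrite actE].
Qed.

Lemma mx_stab_conj g v h : gamma_mx g -> mx_stab v h ->
  mx_stab (mx_act g v) (g *m h *m invmx g).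
Proof.
move=> gg [gh e]; split; first by apply: gamma_mxM; [exact: gamma_mxM|exact: gamma_mxV].
by rewrite !mx_actM mx_actK ?gamma_mx_unit // e.
Qed.

Lemma stab_mx_act g v : gamma_mx g -> is_vertex v ->
  stab (mx_act g v) = conj_class g @` stab v.
Proof.
move=> gg vv; have ug := gamma_mx_unit g gg.
have gvv := mx_act_vertex g v ug vv.
apply/seteqP; split=> P; last first.
  move=> [_ /(stabE _ _ vv)[h sh ->] <-]; rewrite conj_class_pgl.
  by apply/stabE => //; exists (g *m h *m invmx g) => //; apply: mx_stab_conj.
move=> /(stabE _ _ gvv)[h sh ->].
have := mx_stab_conj _ _ _ (gamma_mxV _ gg) sh; rewrite mx_actK // => sh'.
exists (pgl_class (invmx g *m h *m invmx (invmx g))).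
  by apply/stabE => //; eexists; first exact: sh'.
by rewrite conj_class_pgl invmxK !mulmxA (mulmxV ug) mul1mx (mulmxK ug).
Qed.

Lemma edge_stabE v w : edge_stab v w = stab v `&` stab w.
Proof.
by apply/seteqP; split=> P [[gP ev] ew]; split=> //; case: ew.
Qed.

Lemma edge_stab_mx_act g v w : gamma_mx g -> is_vertex v -> is_vertex w ->
  edge_stab (mx_act g v) (mx_act g w) = conj_class g @` edge_stab v w.
Proof.
move=> gg vv ww; rewrite !edge_stabE !stab_mx_act //.
apply/seteqP; split=> [Q [[P sP <-] [P' sP' /(conj_class_inj _ (gamma_mx_unit _ gg)) e]]|].
  by exists P => //; split=> //; rewrite -e.
exact: sub_image_setI.
Qed.

(** Conjugation by [g] is a bijection from the stabilizers at [v] and at the edge onto those at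
    their translates, so the orders may be read before translating. The cardinality hypotheses also
    supply finiteness, without which [fset_set] is empty. *)
Lemma stab_indexE g v w m n : gamma_mx g -> is_vertex v -> is_vertex w ->
  (stab v #= `I_m)%card -> (edge_stab v w #= `I_n)%card ->
  stab_index (mx_act g v) (mx_act g w) = (m %/ n)%N.
Proof.
move=> gg vv ww cv cvw; rewrite /stab_index stab_mx_act // edge_stab_mx_act //.
have card (A : set (set M2)) (p : nat) : (A #= `I_p)%card ->
    #|` fset_set (conj_class g @` A)|%fset = p.
  move=> Ak; apply: card_fset_set; apply: card_eq_trans Ak.
  by apply: inj_card_eq => ? ? _ _; apply: conj_class_inj; apply: gamma_mx_unit.
by rewrite (card _ _ cv) (card _ _ cvw).
Qed.

Lemma stab_orbitE v w : is_vertex v -> is_vertex w ->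
  [set act P w | P in stab v] = [set mx_act h w | h in mx_stab v].
Proof.
move=> vv ww; apply/seteqP; split=> [_ [_ /(stabE _ _ vv)[h sh ->] <-]|_ [h sh <-]].
  by exists h => //; rewrite actE.
by exists (pgl_class h); [apply/stabE => //; exists h|rewrite actE].
Qed.

Lemma mx_stab1 v : mx_stab v 1%:M.
Proof. by split; [exact: gamma_mx1|exact: mx_act1]. Qed.

Lemma mx_stabM v g h : mx_stab v g -> mx_stab v h -> mx_stab v (g *m h).
Proof.
by move=> [gg eg] [gh eh]; split; [exact: gamma_mxM|rewrite mx_actM eh].
Qed.

Lemma mx_stabV v g : mx_stab v g -> mx_stab v (invmx g).
Proof.
move=> [gg eg]; split; first exact: gamma_mxV.
by rewrite -{1}eg mx_actK // gamma_mx_unit.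
Qed.

Lemma mx_orbit_eq v w h : mx_stab v h ->
  [set mx_act k (mx_act h w) | k in mx_stab v] = [set mx_act k w | k in mx_stab v].
Proof.
move=> sh; apply/seteqP; split=> _ [k sk <-].
  by exists (k *m h); [exact: mx_stabM|rewrite mx_actM].
exists (k *m invmx h); first by apply: mx_stabM => //; exact: mx_stabV.
by rewrite mx_actM mx_actK // gamma_mx_unit //; case: sh.
Qed.

End GroupAction.

(** * The adjacency operator on the quotient *)

Section Quotient.
Variables (lift : qvertex -> set (set 'cV[KX]_2)) (hlift : takahashi_domain lift).
Variables (V : nmodType) (f : set (set 'cV[KX]_2) -> V) (f_inv : Gamma_invariant f).

Lemma mx_act_invariant g v : gamma_mx g -> is_vertex v -> f (mx_act g v) = f v.
Proof.
by move=> gg vv; rewrite -actE // f_inv //; apply/GammaE; exists g.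
Qed.

Lemma lift_act_vertex h u : gamma_mx h -> is_vertex (mx_act h (lift u)).
Proof.
move=> gh; apply: mx_act_vertex; first exact: gamma_mx_unit.
exact: (lift_vertex hlift).
Qed.

Lemma lift_orbit_inj g h u u' : gamma_mx g -> gamma_mx h ->
  mx_act g (lift u) = mx_act h (lift u') -> u = u'.
Proof.
move=> gg gh e; have lv := lift_vertex hlift.
apply: (Defs.lift_inj hlift (P := pgl_class (invmx h *m g))).
  by apply/GammaE; exists (invmx h *m g) => //; apply: gamma_mxM => //; exact: gamma_mxV.
by rewrite actE // mx_actM e mx_actK // gamma_mx_unit.
Qed.

Lemma lift_edge_mx u u' : edge_order u u' != 0%N -> exists h,
  [/\ gamma_mx h, Defs.adjacent (lift u) (mx_act h (lift u')),
      (edge_stab (lift u) (mx_act h (lift u')) #= `I_(edge_order u u'))%card &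
      forall k, gamma_mx k -> Defs.adjacent (lift u) (mx_act k (lift u')) ->
        exists2 s, mx_stab (lift u) s & mx_act k (lift u') = mx_act s (mx_act h (lift u'))].
Proof.
have lv := lift_vertex hlift.
move=> /(lift_edge hlift)[_ /GammaE[h gh ->]]; rewrite actE // => -[hadj hcard horb].
exists h; split=> // k gk; rewrite -actE // => kadj.
have [||_ /(stabE _ _ (lv u))[s ss ->] ->] := horb (pgl_class k); first by apply/GammaE; exists k.
  by [].
by exists s => //; rewrite actE //; exact: lift_act_vertex.
Qed.

(** The edge orbits at a translate of [lift u] correspond to the [u'] of nonzero edge order:
    [lift_cover] and [lift_no_edge] place every neighbour over such a [u'], [lift_edge] gives one
    orbit for each, and [lift_inj] keeps the orbits apart. *)
Lemma adjacency_lift u g : gamma_mx g ->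
  adjacency f (mx_act g (lift u)) =
  \sum_(u' \in [set u' | edge_order u u' != 0%N])
     f (lift u') *+ (vertex_order u %/ edge_order u u').
Proof.
move=> gg; have lv := lift_vertex hlift; have ug := gamma_mx_unit g gg.
have /choice[h hE] u' : exists h, edge_order u u' != 0%N ->
  [/\ gamma_mx h, Defs.adjacent (lift u) (mx_act h (lift u')),
      (edge_stab (lift u) (mx_act h (lift u')) #= `I_(edge_order u u'))%card &
      forall k, gamma_mx k -> Defs.adjacent (lift u) (mx_act k (lift u')) ->
        exists2 s, mx_stab (lift u) s & mx_act k (lift u') = mx_act s (mx_act h (lift u'))].
  have [/lift_edge_mx[h hE]|_] := boolP (edge_order u u' != 0%N); first by exists h.
  (* An arbitrary value: [h u'] matters only when the edge order is nonzero. *)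
  by exists 1%:M.
pose v := mx_act g (lift u).
have vv : is_vertex v by exact: lift_act_vertex.
pose W u' := mx_act g (mx_act (h u') (lift u')).
pose E u' := [set mx_act k (W u') | k in mx_stab v].
have WV u' : edge_order u u' != 0%N -> is_vertex (W u').
  by move=> /hE[gh _ _ _]; apply: mx_act_vertex => //; exact: lift_act_vertex.
have orbits : edge_orbits v = E @` [set u' | edge_order u u' != 0%N].
  apply/seteqP; split=> [_ [w [wV adjw] <-]|_ [u' e <-]]; last first.
    exists (W u'); last by rewrite stab_orbitE //; exact: WV.
    by split; [exact: WV|apply: mx_act_adjacent => //; case: (hE u' e)].
  have [_ [u' [/GammaE[k gk ->]]]] := lift_cover hlift wV; rewrite actE // => wE.
  (* Translating back by [invmx g] gives an edge issuing from [lift u] itself, where the data of the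
     domain apply. *)
  pose k' := invmx g *m k.
  have gk' : gamma_mx k' by apply: gamma_mxM => //; exact: gamma_mxV.
  have adjk : Defs.adjacent (lift u) (mx_act k' (lift u')).
    rewrite /k' mx_actM -wE -[X in Defs.adjacent X _](mx_actK g ug).
    by apply: mx_act_adjacent adjw; rewrite unitmx_inv.
  have e : edge_order u u' != 0%N.
    apply/eqP => e; apply: (lift_no_edge hlift e (P := pgl_class k')).
      by apply/GammaE; exists k'.
    by rewrite actE.
  exists u' => //; have [gh _ _ /(_ _ gk' adjk)[s ss hs]] := hE u' e.
  rewrite stab_orbitE //; have -> : w = mx_act (g *m s *m invmx g) (W u').
    by rewrite /W !mx_actM mx_actK // -hs /k' mx_actM mx_actKV.
  by rewrite mx_orbit_eq //; exact: mx_stab_conj.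
have E_inj : set_inj [set u' | edge_order u u' != 0%N] E.
  move=> u1 u2 /set_mem /= e1 /set_mem /= e2 E12.
  have : E u1 (W u1) by exists 1%:M; [exact: mx_stab1|exact: mx_act1].
  rewrite E12 => -[k [gk _] Wk].
  have [gh1 _ _ _] := hE u1 e1; have [gh2 _ _ _] := hE u2 e2.
  move: Wk; rewrite /W -!mx_actM => /esym.
  by apply: lift_orbit_inj; do ![apply: gamma_mxM => //].
rewrite /adjacency -/v orbits fsbig_image //.
apply: eq_fsbigr => u' /set_mem /= e /=; have [gh _ hcard _] := hE u' e.
(* [xget] picks an unspecified point of the orbit, of the form [mx_act k (W u')] with [k] fixing
   [v]; neither [f] nor the index depends on it. *)
have : E u' (xget v (E u')).
  by apply: xgetPex; exists (W u'), 1%:M; [exact: mx_stab1|exact: mx_act1].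
move=> [k [gk kv] <-]; rewrite mx_act_invariant //; last exact: WV.
have hV : is_vertex (mx_act (h u') (lift u')) by exact: lift_act_vertex.
(* Writing [v] as [mx_act k v] makes both ends of the edge translates by the same matrix [k *m g],
   as [stab_indexE] requires. *)
rewrite -{1}kv /v /W !mx_act_invariant // -!mx_actM.
rewrite (mx_actM _ (h u')) (stab_indexE _ _ _ _ _ _ _ _ (lift_stab hlift u) hcard) //.
exact: gamma_mxM.
Qed.

(** The list may contain vertices not joined to [u]: their edge order is 0, and division by 0 is 0
    in [nat], so they contribute nothing. *)
Lemma adjacency_lift_seq u g (r : seq qvertex) : gamma_mx g -> uniq r ->
  (forall u', edge_order u u' != 0%N -> u' \in r) ->
  adjacency f (mx_act g (lift u)) =
  \sum_(u' <- r) f (lift u') *+ (vertex_order u %/ edge_order u u').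
Proof.
move=> gg ur hr; rewrite adjacency_lift // [RHS]fsbig_seq //.
apply: fsbig_widen => [u'|u' [_ /negP]]; first exact: hr.
by rewrite negbK => /eqP e; rewrite /= e divn0 mulr0n.
Qed.

Lemma adjacency_core i g : gamma_mx g ->
  adjacency f (mx_act g (lift (inl i))) =
  \sum_(k < 9) f (lift (inl k)) *+ (core_order i %/ edge_order (inl i) (inl k)) +
  \sum_(j < 4) f (lift (inr (j, 0%N))) *+ (core_order i %/ edge_order (inl i) (inr (j, 0%N))).
Proof.
move=> gg.
pose r : seq qvertex :=
  [seq inl k | k <- index_enum 'I_9] ++ [seq inr (j, 0%N) | j <- index_enum 'I_4].
rewrite (adjacency_lift_seq _ _ r) //.
- by rewrite big_cat !big_map.
- rewrite cat_uniq !map_inj_uniq ?index_enum_uniq //=; [|by move=> ? ? []..].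
  by rewrite andbT -all_predC all_map; apply/allP => j _; apply/negP => /mapP[].
move=> [k _|[j [|n]]]; rewrite mem_cat; last by rewrite /= andbF.
  by apply/orP; left; apply/map_f; rewrite mem_index_enum.
by move=> _; apply/orP; right; apply/mapP; exists j; rewrite ?mem_index_enum.
Qed.

(** The factor 3 is 18/6 or 6/2, according to the cusp. The values of [attach_vertex] start at 1,
    hence the predecessor. *)
Lemma adjacency_cusp0 j g : gamma_mx g ->
  adjacency f (mx_act g (lift (inr (j, 0%N)))) =
  f (lift (inl (inord (attach_vertex j).-1))) *+ 3 + f (lift (inr (j, 1%N))).
Proof.
move=> gg; pose i : 'I_9 := inord (attach_vertex j).-1.
have iE : i.+1 = attach_vertex j.
  by rewrite /i inordK; case: (j) => -[|[|[|[|//]]]].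
rewrite (adjacency_lift_seq _ _ [:: inl i; inr (j, 1%N)]) //.
  rewrite !big_cons big_nil addr0.
  have -> : edge_order (inr (j, 0%N)) (inl i) = attach_order j by rewrite /= iE !eqxx.
  have -> : edge_order (inr (j, 0%N)) (inr (j, 1%N)) = cusp_order j.
    by rewrite /= eqxx muln1.
  by rewrite /vertex_order muln1 -/i; case: (j) => -[|[|[|[|//]]]].
case=> [k|[k m]]; rewrite !inE /=.
  case: (k.+1 =P attach_vertex j) => [kE _|//].
  by apply/orP; left; apply/eqP; congr inl; apply/val_inj/succn_inj; rewrite kE iE.
case: (j =P k) => [<-|//] /=; case: (m =P 1%N) => [-> _|//].
by rewrite eqxx.
Qed.

Lemma adjacency_cuspS j n g : gamma_mx g ->
  adjacency f (mx_act g (lift (inr (j, n.+1)))) =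
  f (lift (inr (j, n))) *+ 3 + f (lift (inr (j, n.+2))).
Proof.
move=> gg.
have vo0 m : (0 < cusp_order j * 3 ^ m)%N.
  by rewrite muln_gt0 expn_gt0 andbT; case: (j) => -[|[|[|[|//]]]].
(* Excludes the outward case of [edge_order] when the neighbour is the previous vertex of the
   ray. *)
have ltS m : (m == m.+2) = false by elim: m.
rewrite (adjacency_lift_seq _ _ [:: inr (j, n); inr (j, n.+2)]) //.
- rewrite !big_cons big_nil addr0.
  have -> : edge_order (inr (j, n.+1)) (inr (j, n)) = vertex_order (inr (j, n)).
    by rewrite /= !eqxx ltS.
  have -> : edge_order (inr (j, n.+1)) (inr (j, n.+2)) = vertex_order (inr (j, n.+1)).
    by rewrite /= !eqxx.
  rewrite divnn [(0 < _)%N]vo0; congr (_ *+ _ + _).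
  by rewrite /vertex_order expnSr mulnA mulKn.
- by rewrite /= !inE andbT; apply/eqP => -[] /eqP; rewrite ltS.
case=> [k|[k m]]; rewrite !inE /=; first by rewrite andbF.
case: (j =P k) => [<-|//] /=; case: (m =P n.+2) => [-> _|_]; first by rewrite eqxx orbT.
by case: (n.+1 =P m.+1) => [[->] _|//]; rewrite eqxx.
Qed.

(** The operator A on functions of the quotient vertices. The sums in the core case run over
    nonadjacent vertices too, with coefficient [_ %/ 0 = 0]. *)
Definition quotient_adjacency (phi : qvertex -> V) (u : qvertex) : V :=
  match u with
  | inl i =>
    \sum_(k < 9) phi (inl k) *+ (core_order i %/ edge_order (inl i) (inl k)) +
    \sum_(j < 4) phi (inr (j, 0%N)) *+ (core_order i %/ edge_order (inl i) (inr (j, 0%N)))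
  | inr (j, 0%N) => phi (inl (inord (attach_vertex j).-1)) *+ 3 + phi (inr (j, 1%N))
  | inr (j, n.+1) => phi (inr (j, n)) *+ 3 + phi (inr (j, n.+2))
  end.

Lemma adjacency_quotient u g : gamma_mx g ->
  adjacency f (mx_act g (lift u)) = quotient_adjacency (f \o lift) u.
Proof.
case: u => [i|[j [|n]]]; [exact: adjacency_core|exact: adjacency_cusp0|exact: adjacency_cuspS].
Qed.

End Quotient.

(** By [lift_cover] and [lift_inj] every vertex of the tree lies over exactly one quotient vertex,
    whose value it receives. *)
Lemma invariant_extension lift (hlift : takahashi_domain lift) (V : nmodType)
    (phi : qvertex -> V) :
  exists2 f, Gamma_invariant f & forall u, f (lift u) = phi u.
Proof.
have lv := lift_vertex hlift.
(* The default [inl 0] is reached only at sets that are not vertices. *)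
pose f v := phi (xget (inl 0) [set u | exists2 g, gamma_mx g & v = mx_act g (lift u)]).
have fE g u : gamma_mx g -> f (mx_act g (lift u)) = phi u.
  move=> gg; congr phi; case: xgetP => [w _ [h gh e]|/(_ u) []]; last by exists g.
  exact/esym/(lift_orbit_inj _ hlift _ _ _ _ gg gh e).
exists f => [P v /GammaE[g gg ->] vv|u]; last first.
  by rewrite -{1}(mx_act1 (lift u)) fE //; exact: gamma_mx1.
have [_ [u [/GammaE[h gh ->]]]] := lift_cover hlift vv; rewrite !actE // => ->.
by rewrite -mx_actM !fE //; exact: gamma_mxM.
Qed.

Lemma eigenfunction_quotient lift (hlift : takahashi_domain lift) (K : pzRingType)
    (l : K) (f : set (set 'cV[KX]_2) -> K) : Gamma_invariant f ->
  (forall v, is_vertex v -> adjacency f v = l * f v) <->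
  (forall u, quotient_adjacency K (f \o lift) u = l * f (lift u)).
Proof.
move=> f_inv; have lv := lift_vertex hlift; split=> [eigen u|eigen v vv].
  rewrite -(adjacency_quotient _ hlift _ _ f_inv _ _ gamma_mx1) mx_act1.
  exact: eigen.
have [_ [u [/GammaE[g gg ->]]]] := lift_cover hlift vv; rewrite actE // => ->.
by rewrite (adjacency_quotient _ hlift) // eigen mx_act_invariant.
Qed.

(** * The scattering matrix *)

Definition colseq {C : nmodType} (n : nat) (s : seq C) : 'cV[C]_n := \col_i s`_i.

Lemma col_ext {K : pzRingType} {n : nat} (A B : 'M[K]_n) :
  (forall v : 'cV_n, A *m v = B *m v) -> A = B.
Proof.
move=> AB; apply/matrixP => i j.
by have := congr1 (fun w : 'cV_n => w i 0) (AB (delta_mx j 0)); rewrite -!colE !mxE.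
Qed.

(* Laplace expansion in a form that unfolds by simplification. *)
Fixpoint laplace_det {K : comNzRingType} (n : nat) (g : nat -> nat -> K) : K :=
  if n is m.+1 then
    foldr (fun j s => g 0%N j * ((-1) ^+ j * laplace_det m (fun i k => g i.+1 (bump j k))) + s)
      0 (iota 0 n)
  else 1.

Lemma det_laplace {K : comNzRingType} (n : nat) (g : nat -> nat -> K) :
  \det (\matrix_(i < n, j < n) g i j) = laplace_det n g.
Proof.
elim: n g => [|n IH] g; first exact: det_mx00.
pose F j := g 0%N j * ((-1) ^+ j * laplace_det n (fun i k => g i.+1 (bump j k))).
have -> : laplace_det n.+1 g = \sum_(j < n.+1) F j.
  by rewrite -(big_mkord xpredT) unlock.
rewrite (expand_det_row _ ord0); apply: eq_bigr => j _.
rewrite /F -IH /cofactor !mxE /=.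
by congr (_ * (_ * \det _)); apply/matrixP => i k; rewrite !mxE.
Qed.

(** The matrix commutes with the swaps of the first two and of the last two coordinates: the
    antisymmetric vectors give the factors a - b and d - e, the symmetric ones the 2 by 2 block with
    rows (a + b, 2c) and (2c, d + e). *)
Lemma det_sym4 {K : comNzRingType} (a b c d e : K) :
  \det (\matrix_(i < 4, j < 4) nth 0 (nth [::] [:: [:: a; b; c; c]; [:: b; a; c; c];
                         [:: c; c; d; e]; [:: c; c; e; d]] i) j) =
  (a - b) * (d - e) * ((a + b) * (d + e) - 4 * c ^+ 2).
Proof.
rewrite (det_laplace 4 (fun i j => nth 0 (nth [::] [:: [:: a; b; c; c]; [:: b; a; c; c];
                         [:: c; c; d; e]; [:: c; c; e; d]] i) j)).
by rewrite /laplace_det /= /bump /=; ring.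
Qed.

(** * Explicit solution of the core system and the entries of [S_X] *)

Section ScatteringMatrix.
Variable R : realType.
Local Notation C := R[i].
Local Notation r2 := (sqrtC 2 : C).
Local Notation r3 := (sqrtC 3 : C).

Lemma r2_sqr : r2 ^+ 2 = 2. Proof. exact: sqrtCK. Qed.
Lemma r3_sqr : r3 ^+ 2 = 3. Proof. exact: sqrtCK. Qed.
Lemma r2_neq0 : r2 != 0. Proof. by rewrite sqrtC_eq0 pnatr_eq0. Qed.
Lemma r3_neq0 : r3 != 0. Proof. by rewrite sqrtC_eq0 pnatr_eq0. Qed.

Lemma adjoint_Vmx : adjoint (Vmx R) = (Vmx R)^T.
Proof.
apply/matrixP => i j; rewrite !mxE rmorphM /= conjC_nat.
by congr (_ * _); apply/CrealP; rewrite ger0_real // sqrtC_ge0 ler0n.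
Qed.

Lemma HC_col (u1 u2 u3 u4 u5 u6 u7 u8 u9 : C) :
  HC R *m colseq 9 [:: u1; u2; u3; u4; u5; u6; u7; u8; u9] =
  colseq 9 [:: 2 * u2 + r2 * u3; 2 * u1; r2 * u1 + r3 * u4;
    r3 * u3 + 2 * u5 + r2 * u6 + r3 * u7; 2 * u4; r2 * u4;
    r3 * u4 + r2 * u8; r2 * u7 + 2 * u9; 2 * u8].
Proof.
apply/matrixP => i j; rewrite !mxE !big_ord_recl big_ord0 !mxE /core_entry.
move: (sqrtC 2 : C) (sqrtC 3 : C) => a b.
by case: i => -[|[|[|[|[|[|[|[|[|//]]]]]]]]] i; rewrite /=; ring.
Qed.

Lemma VmxT_col (u1 u2 u3 u4 u5 u6 u7 u8 u9 : C) :
  (Vmx R)^T *m colseq 9 [:: u1; u2; u3; u4; u5; u6; u7; u8; u9] =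
  r3 *: colseq 4 [:: u1; u8; u6; u6].
Proof.
apply/matrixP => i j; rewrite !mxE !big_ord_recl big_ord0 !mxE /sqrt3.
move: (sqrtC 3 : C) => b.
by case: i => -[|[|[|[|//]]]] i; rewrite /attach_vertex /=; ring.
Qed.

Lemma Vmx_col (b1 b2 b3 b4 : C) :
  Vmx R *m colseq 4 [:: b1; b2; b3; b4] =
  r3 *: colseq 9 [:: b1; 0; 0; 0; 0; b3 + b4; 0; b2; 0].
Proof.
apply/matrixP => i j; rewrite !mxE !big_ord_recl big_ord0 !mxE /sqrt3.
move: (sqrtC 3 : C) => b.
by case: i => -[|[|[|[|[|[|[|[|[|//]]]]]]]]] i; rewrite /attach_vertex /=; ring.
Qed.

(** Each cusp adds sqrt 3 mu^-1 to the diagonal at its attachment vertex. This cancels the term in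
    mu^-1 at v_1 and v_8 and, since v_6 carries two cusps, reverses its sign there. *)
Lemma FX_col (mu u1 u2 u3 u4 u5 u6 u7 u8 u9 : C) :
  let t := r3 * (mu + mu^-1) in
  FX mu *m colseq 9 [:: u1; u2; u3; u4; u5; u6; u7; u8; u9] =
  colseq 9 [:: 2 * u2 + r2 * u3 - r3 * mu * u1; 2 * u1 - t * u2;
    r2 * u1 + r3 * u4 - t * u3;
    r3 * u3 + 2 * u5 + r2 * u6 + r3 * u7 - t * u4; 2 * u4 - t * u5;
    r2 * u4 + r3 * (mu^-1 - mu) * u6;
    r3 * u4 + r2 * u8 - t * u7; r2 * u7 + 2 * u9 - r3 * mu * u8; 2 * u8 - t * u9].
Proof.
move=> t; rewrite /FX mulmxDl mulmxBl HC_col -scalemxAl -mulmxA adjoint_Vmx.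
rewrite VmxT_col mul_scalar_mx -scalemxAr Vmx_col !scalerA /sqrt3 -/t.
have r30 := r3_neq0.
have -> : mu^-1 / r3 * r3 * r3 = r3 * mu^-1 by rewrite mulfVK // mulrC.
rewrite /t; move: (sqrtC 2 : C) (sqrtC 3 : C) (mu^-1) => a b nu.
apply/matrixP => i j; rewrite !mxE.
by case: i => -[|[|[|[|[|[|[|[|[|//]]]]]]]]] i; rewrite /=; ring.
Qed.

(* The core is a tree with leaves v_2, v_5, v_9: their coordinates x, y, z
   determine, by the rows 2, 3, 5, 7, 9 of [FX mu], all the others but that of
   v_6. *)
Definition core_vec (mu x y z u6 : C) : 'cV[C]_9 :=
  let t := r3 * (mu + mu^-1) in
  colseq 9 [:: t * x / 2; x; (r2 * x + r3 * y) / 2; t * y / 2; y; u6;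
               (r2 * z + r3 * y) / 2; t * z / 2; z].

(** On the vectors [core_vec] only rows 1, 4, 6, 8 remain, a system in the four unknowns x, y, z,
    u6. *)
Lemma FX_core_vec (mu x y z u6 : C) : mu != 0 ->
  FX mu *m core_vec mu x y z u6 =
  colseq 9 [:: 3 / 2 * (1 - mu ^+ 2) * x + r2 * r3 / 2 * y; 0; 0;
    r2 * r3 / 2 * (x + z) + r2 * u6 + (5 - 3 / 2 * (mu + mu^-1) ^+ 2) * y; 0;
    r3 * mu^-1 * (r2 / 2 * (mu ^+ 2 + 1) * y + (1 - mu ^+ 2) * u6);
    0; 3 / 2 * (1 - mu ^+ 2) * z + r2 * r3 / 2 * y; 0].
Proof.
move=> mu0; rewrite FX_col.
apply/matrixP => i j; rewrite !mxE; move: r2_sqr r3_sqr.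
have two0 : (2 : C) != 0 by rewrite pnatr_eq0.
move: (sqrtC 2 : C) (sqrtC 3 : C) => a b a2 b2.
by case: i => -[|[|[|[|[|[|[|[|[|//]]]]]]]]] i; rewrite /=; field: a2 b2; rewrite ?mu0.
Qed.

Lemma colseq4 (v : 'cV[C]_4) : v = colseq 4 [:: v 0 0; v 1 0; v 2 0; v 3 0].
Proof.
apply/matrixP => i j; rewrite !mxE ord1.
by case: i => -[|[|[|[|//]]]] i /=; congr (v _ _); apply/val_inj.
Qed.

Lemma colseq9 (v : 'cV[C]_9) :
  v = colseq 9 [:: v 0 0; v 1 0; v 2 0; v 3 0; v 4 0; v 5 0; v 6 0; v 7 0; v 8 0].
Proof.
apply/matrixP => i j; rewrite !mxE ord1.
by case: i => -[|[|[|[|[|[|[|[|[|//]]]]]]]]] i /=; congr (v _ _); apply/val_inj.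
Qed.

(** At a zero of [Delta] there is an explicit kernel vector: the choice y = 1 - mu^2 solves rows 1,
    6, 8 without division, and row 4 then equals Delta / (2 mu^2). *)
Lemma Delta_neq0 (mu : C) : mu != 0 -> FX mu \in unitmx -> Delta mu != 0.
Proof.
move=> mu0 uF; apply/eqP => D0.
pose x := - (r2 * r3 / 3) : C.
pose v := core_vec mu x (1 - mu ^+ 2) x (- (r2 / 2) * (mu ^+ 2 + 1)).
have Fv : FX mu *m v = 0.
  rewrite FX_core_vec // /x.
  have two0 : (2 : C) != 0 by rewrite pnatr_eq0.
  have three0 : (3 : C) != 0 by rewrite pnatr_eq0.
  apply/matrixP => i j; rewrite !mxE; move: r2_sqr r3_sqr D0; rewrite /Delta.
  move: (sqrtC 2 : C) (sqrtC 3 : C) => a b a2 b2 D0.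
  case: i => -[|[|[|[|[|[|[|[|[|//]]]]]]]]] i //=; try by field: a2 b2.
  have -> : a * b / 2 * (- (a * b / 3) - a * b / 3) + a * (- (a / 2) * (mu ^+ 2 + 1)) +
     (5 - 3 / 2 * (mu + mu^-1) ^+ 2) * (1 - mu ^+ 2) =
     ((mu ^+ 2 - 3) * (3 * mu ^+ 4 + 1)) / (2 * mu ^+ 2).
    by field: a2 b2; rewrite mu0.
  by rewrite D0 mul0r.
(* The coordinate at the leaf v_2 is x, a nonzero constant, so [v] is nonzero for every mu. *)
have := congr1 (fun w : 'cV[C]_9 => w 1 0) (mulKmx uF v).
rewrite Fv mulmx0 !mxE /= /x => /esym/eqP.
by rewrite oppr_eq0 !mulf_eq0 (negPf r2_neq0) (negPf r3_neq0) invr_eq0 pnatr_eq0.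
Qed.

(** Rows 1, 8, 6 express x, z, u6 through y, and row 4 then gives Delta times y. The factor 1 - mu^2
    is kept in y, so the formulas hold at mu^2 = 1 as well; they are checked by applying [FX mu]. *)
Lemma FX_inv_V (mu b1 b2 b3 b4 : C) : mu != 0 -> FX mu \in unitmx ->
  let w := mu * (b1 + b2 + mu * (b3 + b4)) / Delta mu in
  invmx (FX mu) *m ((mu^-1 - mu) *: (Vmx R *m colseq 4 [:: b1; b2; b3; b4])) =
  core_vec mu (2 / 3 * r3 * (b1 / mu) + 4 / 3 * r3 * w) (- (2 * r2 * (1 - mu ^+ 2) * w))
    (2 / 3 * r3 * (b2 / mu) + 4 / 3 * r3 * w) (b3 + b4 + 2 * (mu ^+ 2 + 1) * w).
Proof.
move=> mu0 uF w; have DN0 := Delta_neq0 mu mu0 uF.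
apply: (canLR (mulKmx uF)); rewrite FX_core_vec // Vmx_col.
have two0 : (2 : C) != 0 by rewrite pnatr_eq0.
have three0 : (3 : C) != 0 by rewrite pnatr_eq0.
apply/matrixP => i j; rewrite !mxE; move: r2_sqr r3_sqr DN0; rewrite /w /Delta.
move: (sqrtC 2 : C) (sqrtC 3 : C) => a b aa bb /[!mulf_eq0]/norP[D1 D2].
by case: i => -[|[|[|[|[|[|[|[|[|//]]]]]]]]] i //=; field: aa bb; rewrite ?mu0 ?D1 ?D2.
Qed.

Lemma SX_mul (mu : C) (v : 'cV[C]_4) :
  SX mu *m v = - v + r3^-1 *: ((Vmx R)^T *m
    (invmx (FX mu) *m ((mu^-1 - mu) *: (Vmx R *m v)))).
Proof.
rewrite /SX mulmxDl mulNmx mul1mx -scalemxAl -!mulmxA [_ / _]mulrC -scalerA.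
by rewrite (scalemxAr _ (adjoint _)) (scalemxAr _ (invmx _)) adjoint_Vmx.
Qed.

(** Thus [S_X] is diag(mu^-2, mu^-2) on the first two cusps and the swap on the last two, plus 2
    (mu^2 + 1) / Delta times the rank-one matrix r r^T with r = (1, 1, mu, mu). *)
Lemma SX_col (mu b1 b2 b3 b4 : C) : mu != 0 -> FX mu \in unitmx ->
  let w := 2 * (mu ^+ 2 + 1) * (b1 + b2 + mu * (b3 + b4)) / Delta mu in
  SX mu *m colseq 4 [:: b1; b2; b3; b4] =
  colseq 4 [:: b1 / mu ^+ 2 + w; b2 / mu ^+ 2 + w; b4 + mu * w; b3 + mu * w].
Proof.
move=> mu0 uF w; have DN0 := Delta_neq0 mu mu0 uF.
rewrite SX_mul FX_inv_V // VmxT_col scalerA mulVf ?r3_neq0 // scale1r.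
have two0 : (2 : C) != 0 by rewrite pnatr_eq0.
have three0 : (3 : C) != 0 by rewrite pnatr_eq0.
apply/matrixP => i j; rewrite !mxE; move: r3_sqr DN0; rewrite /w /Delta.
move: (sqrtC 3 : C) => a aa /[!mulf_eq0]/norP[D1 D2].
by case: i => -[|[|[|[|//]]]] i /=; field: aa; rewrite ?mu0 ?D1 ?D2.
Qed.

(** [E] lists the roots of mu (mu^2 + 1) (1 - mu^2) Delta. Elsewhere mu^2 + 1 != 0 forces a kernel
    vector into the form [core_vec], Delta != 0 kills y, and 1 - mu^2 != 0 kills x, z and u6. *)
Lemma FX_unitmx_cofinite : exists E : seq C, forall mu, mu \notin E -> FX mu \in unitmx.
Proof.
pose P : {poly C} := 'X * ('X^2 + 1) * (1 - 'X^2) * (('X^2 - 3%:P) * (3 *: 'X^4 + 1)).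
have PE (mu : C) : P.[mu] = mu * (mu ^+ 2 + 1) * (1 - mu ^+ 2) * Delta mu.
  by rewrite /P /Delta !hornerE.
have P0 : P != 0.
  (* One value suffices to see that [P] is nonzero; at 2 it is -1470. *)
  apply/eqP => P0; have := PE 2; rewrite P0 horner0 => /esym/eqP.
  have -> : (2 : C) * (2 ^+ 2 + 1) * (1 - 2 ^+ 2) * Delta 2 = - 1470%:R.
    by rewrite /Delta; ring.
  by rewrite oppr_eq0 pnatr_eq0.
have [E Ef] := closed_field_poly_normal P.
exists E => mu muE; have : ~~ root P mu.
  by rewrite Ef rootZ ?lead_coef_eq0 // root_prod_XsubC.
rewrite rootE PE 3!mulf_eq0 !negb_or => /andP[/andP[/andP[mu0 t0] k0] DN0].
(* [det0P] yields a row vector in the left kernel, hence the transposition. *)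
rewrite -unitmx_tr unitmxE unitfE; apply/negP => /det0P[v v0].
move=> /(congr1 trmx); rewrite trmx_mul trmxK trmx0 => Fv.
case/negP: v0; rewrite -(trmxK v) trmx_eq0; apply/eqP; move: Fv.
rewrite (colseq9 v^T).
move: (v^T 0 0) (v^T 1 0) (v^T 2 0) (v^T 3 0) (v^T 4 0) (v^T 5 0) (v^T 6 0) (v^T 7 0) (v^T 8 0).
move=> {v} u1 u2 u3 u4 u5 u6 u7 u8 u9 Fu.
have two0 : (2 : C) != 0 by rewrite pnatr_eq0.
have three0 : (3 : C) != 0 by rewrite pnatr_eq0.
have r30 := r3_neq0.
have tN0 : r3 * (mu + mu^-1) != 0.
  rewrite mulf_neq0 //; apply: contra t0 => /eqP t0.
  have -> : mu ^+ 2 + 1 = mu * (mu + mu^-1) by field.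
  by rewrite t0 mulr0.
have uE : colseq 9 [:: u1; u2; u3; u4; u5; u6; u7; u8; u9] = core_vec mu u2 u5 u9 u6.
  have row i := congr1 (fun w : 'cV[C]_9 => w i 0) Fu.
  move: (row 1) (row 2) (row 4) (row 6) (row 8); rewrite FX_col !mxE /= /core_vec.
  move: (r3 * (mu + mu^-1)) tN0 => t tN0.
  move=> /subr0_eq e2 /subr0_eq e3 /subr0_eq e5 /subr0_eq e7 /subr0_eq e9.
  have u1E : u1 = t * u2 / 2 by rewrite -e2 mulrAC mulfV // mul1r.
  have u4E : u4 = t * u5 / 2 by rewrite -e5 mulrAC mulfV // mul1r.
  have u8E : u8 = t * u9 / 2 by rewrite -e9 mulrAC mulfV // mul1r.
  have -> : u3 = (r2 * u2 + r3 * u5) / 2.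
    by apply: (mulfI tN0); rewrite -e3 u1E u4E; field.
  have -> : u7 = (r2 * u9 + r3 * u5) / 2.
    by apply: (mulfI tN0); rewrite -e7 u4E u8E; field.
  by rewrite -u1E -u4E -u8E.
rewrite uE in Fu *.
have row i := congr1 (fun w : 'cV[C]_9 => w i 0) Fu.
move: (row 0) (row 3) (row 5) (row 7); rewrite FX_core_vec // !mxE /=.
rewrite -(mulrA r3) => e1 e4 /eqP; rewrite mulf_eq0 (negPf r30) mulf_eq0 invr_eq0.
rewrite (negPf mu0) /= => /eqP e6 e8.
have u5_0 : u5 = 0.
  suff /eqP : Delta mu * u5 = 0 by rewrite mulf_eq0 (negPf DN0) => /eqP.
  move: e1 e4 e6 e8 r2_sqr r3_sqr; rewrite /Delta.
  move: (sqrtC 2 : C) (sqrtC 3 : C) => a b e1 e4 e6 e8 aa bb.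
  (* This combination of rows 4, 1, 8 and 6 eliminates u2, u9 and u6. *)
  have -> : (mu ^+ 2 - 3) * (3 * mu ^+ 4 + 1) * u5 = 2 * mu ^+ 2 * (
    (1 - mu ^+ 2) * (a * b / 2 * (u2 + u9) + a * u6 + (5 - 3 / 2 * (mu + mu^-1) ^+ 2) * u5)
    - a * b / 3 * (3 / 2 * (1 - mu ^+ 2) * u2 + a * b / 2 * u5
                   + (3 / 2 * (1 - mu ^+ 2) * u9 + a * b / 2 * u5))
    - a * (a / 2 * (mu ^+ 2 + 1) * u5 + (1 - mu ^+ 2) * u6)).
    by field: aa bb; rewrite mu0.
  by rewrite e1 e4 e6 e8 !(mulr0, addr0, subr0).
have half3 : 3 / 2 * (1 - mu ^+ 2) != 0 by rewrite !mulf_neq0 ?invr_eq0.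
move: e1 e6 e8; rewrite u5_0 !mulr0 !(addr0, add0r) => /eqP.
rewrite mulf_eq0 (negPf half3) => /eqP ->  /eqP; rewrite mulf_eq0 (negPf k0) => /eqP -> /eqP.
rewrite mulf_eq0 (negPf half3) => /eqP ->; rewrite /core_vec !(mulr0, mul0r, addr0).
by apply/matrixP => i j; rewrite !mxE; case: i => -[|[|[|[|[|[|[|[|[|//]]]]]]]]].
Qed.

(** Matching the entries with [SX_col] rests on the identity p = Delta + beta2. *)
Lemma SXE (mu : C) : mu != 0 -> FX mu \in unitmx ->
  SX mu = (Delta mu)^-1 *: mx_of_rows 4 4
    [:: [:: p_X mu / mu ^+ 2; beta0 mu; beta1 mu; beta1 mu];
        [:: beta0 mu; p_X mu / mu ^+ 2; beta1 mu; beta1 mu];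
        [:: beta1 mu; beta1 mu; beta2 mu; p_X mu];
        [:: beta1 mu; beta1 mu; p_X mu; beta2 mu]].
Proof.
move=> mu0 uF; apply: col_ext => v; rewrite (colseq4 v) SX_col // -scalemxAl.
have := Delta_neq0 mu mu0 uF.
move: (v 0 0) (v 1 0) (v 2 0) (v 3 0) => b1 b2 b3 b4.
rewrite /p_X /beta0 /beta1 /beta2 /Delta => /[!mulf_eq0]/norP[D1 D2].
apply/matrixP => i j; rewrite !mxE !big_ord_recl big_ord0 !mxE.
by case: i => -[|[|[|[|//]]]] i /=; field; rewrite ?mu0 ?D1 ?D2.
Qed.

(** The antisymmetric vectors of [det_sym4] contribute the eigenvalues mu^-2 and -1 of [S_X]; the
    rest is the symmetric block. *)
Lemma det_SX (mu : C) : mu != 0 -> FX mu \in unitmx ->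
  \det (SX mu) = - (((3 * mu ^+ 2 - 1) * (mu ^+ 4 + 3)) /
                    (mu ^+ 4 * (mu ^+ 2 - 3) * (3 * mu ^+ 4 + 1))).
Proof.
move=> mu0 uF; have := Delta_neq0 mu mu0 uF; rewrite SXE // detZ.
rewrite /Delta => /[!mulf_eq0]/norP[D1 D2].
rewrite /mx_of_rows det_sym4 /p_X /beta0 /beta1 /beta2 /Delta.
by field; rewrite ?mu0 ?D1 ?D2.
Qed.

End ScatteringMatrix.

(** * Generalized eigenfunctions *)

Section Qpow.
Variable R : realType.
Local Notation C := R[i].

Lemma expCD (z w : C) : expC (z + w) = expC z * expC w.
Proof.
case: z w => [a b] [c d]; rewrite /expC /= expRD sinD cosD.
by apply/eqP; rewrite eq_complex /=; apply/andP; split; apply/eqP; ring.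
Qed.

Lemma qpowD (z w : C) : qpow (z + w) = qpow z * qpow w.
Proof. by rewrite /qpow mulrDl expCD. Qed.

Lemma expC_real (x : R) : expC x%:C%C = (expR x)%:C%C.
Proof. by rewrite /expC /= cos0 sin0 mulr1. Qed.

Lemma qpow1 : qpow (1 : C) = 3.
Proof.
by rewrite /qpow mul1r expC_real lnK ?posrE ?ltr0n // rmorph_nat.
Qed.

Lemma qpow0 : qpow (0 : C) = 1.
Proof. by rewrite /qpow mul0r expC_real expR0. Qed.

Lemma qpowN (z : C) : qpow (- z) = (qpow z)^-1.
Proof.
have e : qpow (- z) * qpow z = 1 by rewrite -qpowD addNr qpow0.
have z0 : qpow z != 0 by apply/eqP => z0; move/eqP: e; rewrite z0 mulr0 eq_sym oner_eq0.
by apply: (mulIf z0); rewrite e mulVf.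
Qed.

Lemma qpow_neq0 (z : C) : qpow z != 0.
Proof.
apply/eqP => z0; have /eqP := qpowD z (- z).
by rewrite subrr qpow0 z0 mul0r oner_eq0.
Qed.

Lemma qpowMn (n : nat) (z : C) : qpow (n%:R * z) = qpow z ^+ n.
Proof.
elim: n => [|n IH]; first by rewrite mul0r qpow0.
by rewrite -natr1 mulrDl mul1r qpowD IH exprSr.
Qed.

(** Both sides square to 3, and the left one, a real exponential, is the nonnegative root. *)
Lemma qpow_half : qpow (2^-1 : C) = sqrtC 3.
Proof.
have e : qpow (2^-1 : C) ^+ 2 = 3.
  by rewrite -qpowMn mulfV ?pnatr_eq0 // qpow1.
rewrite -[LHS]sqrCK ?e // /qpow.
have -> : 2^-1 * (ln 3 : R)%:C%C = (2^-1 * ln 3 : R)%:C%C :> C.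
  by rewrite rmorphM fmorphV rmorph_nat.
by rewrite expC_real lecR expR_ge0.
Qed.

Lemma qpow_mu (s : C) : qpow s = sqrtC 3 * mu_of s.
Proof. by rewrite -qpow_half /mu_of -qpowD; congr qpow; ring. Qed.

Lemma qpow_muV (s : C) : qpow (1 - s) = sqrtC 3 / mu_of s.
Proof. by rewrite -qpow_half /mu_of -qpowN -qpowD; congr qpow; field. Qed.

End Qpow.

(** * The eigenvalue equation as a linear system on the core *)

Section Eigenfunctions.
Variable R : realType.
Local Notation C := R[i].
Local Notation r2 := (sqrtC 2 : C).
Local Notation r3 := (sqrtC 3 : C).

Lemma quotient_adjacency_core (phi : qvertex -> C) :
  let x k := phi (inl (inord k.-1)) in
  let c k := phi (inr (inord k.-1, 0%N)) in
  \col_i quotient_adjacency C phi (inl i) =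
  colseq 9 [:: x 2 + 2 * x 3 + c 1; 4 * x 1; x 1 + 3 * x 4; x 3 + x 5 + x 6 + x 7; 4 * x 4;
    2 * x 4 + c 3 + c 4; 3 * x 4 + x 8; 2 * x 7 + x 9 + c 2; 4 * x 8].
Proof.
move=> x c; apply/matrixP => i j; rewrite !mxE {j} /quotient_adjacency.
have xE (k : 'I_9) : phi (inl k) = x k.+1 by rewrite /x /= inord_val.
have cE (k : 'I_4) : phi (inr (k, 0%N)) = c k.+1 by rewrite /c /= inord_val.
under eq_bigr => k _ do rewrite xE.
under [X in _ + X]eq_bigr => k _ do rewrite cE.
clearbody x c; rewrite !big_ord_recl !big_ord0.
(* The indices other than n/0, n/1 and n/n are 6/3 = 2 and 24/6 = 4. *)
by case: i => -[|[|[|[|[|[|[|[|[|//]]]]]]]]] i;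
  rewrite /core_order /attach_order /bump /= ?addn0 ?add0n ?divn0 ?divn1 ?divnn
    -?[(6 %/ 3)%N]/2%N -?[(24 %/ 6)%N]/4%N /=; ring.
Qed.

(* Multiplication by [lambda^(1/2)], up to the factor [6^(1/2)]. *)
Definition jacobi_scale (x : seq C) : 'cV[C]_9 :=
  colseq 9 [:: x`_0; x`_1 / 2; r2 * x`_2; r2 * r3 * x`_3; r2 * r3 / 2 * x`_4;
               r3 * x`_5; r2 * x`_6; x`_7; x`_8 / 2].

Lemma jacobi_scale_surj (w : 'cV[C]_9) : exists y1 y2 y3 y4 y5 y6 y7 y8 y9,
  jacobi_scale [:: y1; y2; y3; y4; y5; y6; y7; y8; y9] = w.
Proof.
exists (w 0 0), (2 * w 1 0), (w 2 0 / r2), (w 3 0 / (r2 * r3)), (2 * w 4 0 / (r2 * r3)),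
  (w 5 0 / r3), (w 6 0 / r2), (w 7 0), (2 * w 8 0).
rewrite [RHS]colseq9 /jacobi_scale.
have two0 : (2 : C) != 0 by rewrite pnatr_eq0.
have a0 := r2_neq0 R; have b0 := r3_neq0 R.
apply/matrixP => i j; rewrite !mxE; move: (sqrtC 2 : C) (sqrtC 3 : C) a0 b0 => a b a0 b0.
by case: i => -[|[|[|[|[|[|[|[|[|//]]]]]]]]] i; rewrite //=; field; rewrite ?a0 ?b0.
Qed.

(** Here [c b d] is the value at the first cusp vertex. Once the attachment equations eliminate the
    d_i, each row of the first system is a nonzero multiple of the same row of the second. *)
Lemma jacobi_conjugation (mu x1 x2 x3 x4 x5 x6 x7 x8 x9 b1 b2 b3 b4 d1 d2 d3 d4 : C) :
  mu != 0 -> b1 + d1 = x1 -> b2 + d2 = x8 -> b3 + d3 = x6 -> b4 + d4 = x6 ->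
  let c b d := r3 * mu * b + r3 / mu * d in
  FX mu *m jacobi_scale [:: x1; x2; x3; x4; x5; x6; x7; x8; x9] =
    (mu^-1 - mu) *: (Vmx R *m colseq 4 [:: b1; b2; r3 * b3; r3 * b4]) <->
  colseq 9 [:: x2 + 2 * x3 + c b1 d1; 4 * x1; x1 + 3 * x4; x3 + x5 + x6 + x7; 4 * x4;
    2 * x4 + c b3 d3 + c b4 d4; 3 * x4 + x8; 2 * x7 + x9 + c b2 d2; 4 * x8] =
  (r3 * (mu + mu^-1)) *: colseq 9 [:: x1; x2; x3; x4; x5; x6; x7; x8; x9].
Proof.
move=> mu0; do 4!move/(canRL (addKr _)) => ->; move=> c.
rewrite /jacobi_scale FX_col Vmx_col /=.
(* The scaling of the constant function 1 lists the diagonal entries of the scaling. *)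
pose l : 'cV[C]_9 := jacobi_scale (nseq 9 1).
set A := colseq 9 _; set B := _ *: (_ *: _); set A' := colseq 9 _; set B' := _ *: _.
have two0 : (2 : C) != 0 by rewrite pnatr_eq0.
have key i : A i 0 - B i 0 = l i 0 * (A' i 0 - B' i 0).
  rewrite /A /B /A' /B' /l /jacobi_scale !mxE /c; move: (r2_sqr R) (r3_sqr R).
  move: (sqrtC 2 : C) (sqrtC 3 : C) => a b aa bb.
  by case: i => -[|[|[|[|[|[|[|[|[|//]]]]]]]]] i; rewrite /=; field: aa bb; rewrite ?mu0.
have l0 i : l i 0 != 0.
  rewrite /l /jacobi_scale !mxE.
  by case: i => -[|[|[|[|[|[|[|[|[|//]]]]]]]]] i;
    rewrite /= ?mulr1 ?mul1r ?mulf_neq0 ?invr_eq0 ?oner_neq0 ?r2_neq0 ?r3_neq0.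
split=> e; apply/matrixP => i j; rewrite ord1; apply/eqP; rewrite -subr_eq0; last first.
  by rewrite key e subrr mulr0.
by have /eqP := key i; rewrite e subrr eq_sym mulf_eq0 (negPf (l0 i)).
Qed.

Lemma D0_mul (b : 'cV[C]_4) :
  D0 R *m b = colseq 4 [:: b 0 0; b 1 0; r3 * b 2 0; r3 * b 3 0].
Proof.
rewrite [in LHS](colseq4 R b) /D0 mul_diag_mx.
apply/matrixP => i j; rewrite !mxE /sqrt3; move: (sqrtC 3 : C) => a.
by case: i => -[|[|[|[|//]]]] i; rewrite /= ?mul1r.
Qed.

Lemma D0_unit : D0 R \in unitmx.
Proof.
rewrite unitmxE det_diag unitfE; apply/prodf_neq0 => i _; rewrite mxE.
by case: i => -[|[|[|[|//]]]] i; rewrite /= ?oner_neq0 ?r3_neq0.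
Qed.

Lemma quotient_core_eigen (phi : qvertex -> C) (l : C) :
  let x k := phi (inl (inord k.-1)) in
  let c k := phi (inr (inord k.-1, 0%N)) in
  (forall i, quotient_adjacency C phi (inl i) = l * phi (inl i)) <->
  colseq 9 [:: x 2 + 2 * x 3 + c 1; 4 * x 1; x 1 + 3 * x 4; x 3 + x 5 + x 6 + x 7; 4 * x 4;
    2 * x 4 + c 3 + c 4; 3 * x 4 + x 8; 2 * x 7 + x 9 + c 2; 4 * x 8] =
  l *: colseq 9 [:: x 1; x 2; x 3; x 4; x 5; x 6; x 7; x 8; x 9].
Proof.
move=> x c; rewrite -quotient_adjacency_core.
have xE i : (colseq 9 [:: x 1; x 2; x 3; x 4; x 5; x 6; x 7; x 8; x 9]) i 0 = phi (inl i).
  rewrite mxE /x; case: i => -[|[|[|[|[|[|[|[|[|//]]]]]]]]] i /=;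
  by congr (phi (inl _)); apply/val_inj; rewrite /= inordK.
split=> [e|e i]; first by apply/matrixP => i j; rewrite ord1 !mxE e -xE mxE.
by have := congr1 (fun w : 'cV[C]_9 => w i 0) e; rewrite [X in _ = X -> _]mxE xE mxE.
Qed.

(** As p q = 3, both p and q are roots of T^2 - (p + q) T + 3, so the equations beyond the first
    cusp vertex hold identically; the first leaves the defect computed in [key]. *)
Lemma quotient_cusp_eigen (phi : qvertex -> C) (p q : C) (b d : 'cV[C]_4) :
  p * q = 3 ->
  (forall j n, phi (inr (j, n)) = p ^+ n.+1 * b j 0 + q ^+ n.+1 * d j 0) ->
  (forall z, quotient_adjacency C phi (inr z) = (p + q) * phi (inr z)) <->
  (forall j, b j 0 + d j 0 = phi (inl (inord (attach_vertex j).-1))).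
Proof.
move=> pq phiE.
have three0 : (3 : C) != 0 by rewrite pnatr_eq0.
have key j : quotient_adjacency C phi (inr (j, 0%N)) - (p + q) * phi (inr (j, 0%N)) =
    3 * (phi (inl (inord (attach_vertex j).-1)) - (b j 0 + d j 0)).
  by rewrite /= !phiE -mulr_natl; ring: pq.
split=> [e j|e [j [|n]]].
- have /eqP := key j; rewrite e subrr eq_sym mulf_eq0 (negPf three0) subr_eq0.
  by move/eqP.
- by apply/eqP; rewrite -subr_eq0 key e subrr mulr0.
by rewrite /= !phiE -mulr_natl !exprS; ring: pq.
Qed.

(** Stated for arbitrary [b] and [d], this gives both existence and uniqueness of the outgoing term,
    and serves both normalizations. *)
Lemma generalized_eigenfunctionP lift (hlift : takahashi_domain lift) (s : C) (b d : 'cV[C]_4) :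
  FX (mu_of s) \in unitmx ->
  (exists f, generalized_eigenfunction lift s b d f) <->
  D0 R *m d = SX (mu_of s) *m (D0 R *m b).
Proof.
set mu := mu_of s => uF; have mu0 : mu != 0 by exact: qpow_neq0.
have r30 := r3_neq0 R.
pose p := qpow s; pose q := qpow (1 - s).
have pE : p = r3 * mu by exact: qpow_mu.
have qE : q = r3 / mu by exact: qpow_muV.
have pq : p * q = 3 by rewrite pE qE mulrACA mulfV // mulr1 -expr2 r3_sqr.
have pDq : p + q = r3 * (mu + mu^-1) by rewrite pE qE mulrDr.
have cuspE j n : qpow (n.+1%:R * s) * b j 0 + qpow (n.+1%:R * (1 - s)) * d j 0 =
    p ^+ n.+1 * b j 0 + q ^+ n.+1 * d j 0 by rewrite !qpowMn.
have ord4 : [/\ inord 0 = 0 :> 'I_4, inord 1 = 1 :> 'I_4, inord 2 = 2 :> 'I_4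
    & inord 3 = 3 :> 'I_4] by split; apply/val_inj; rewrite /= inordK.
rewrite SX_mul; split=> [[f [f_inv /(eigenfunction_quotient _ hlift _ _ _ f_inv) feig fcusp]]|].
  pose phi := f \o lift; rewrite -/phi -/p -/q in feig.
  have phiE j n : phi (inr (j, n)) = p ^+ n.+1 * b j 0 + q ^+ n.+1 * d j 0.
    by rewrite /phi /= fcusp cuspE.
  have attach := (quotient_cusp_eigen _ _ _ _ _ pq phiE).1 (fun z => feig (inr z)).
  have core := (quotient_core_eigen _ _).1 (fun i => feig (inl i)).
  move: core; case: ord4 => e0 e1 e2 e3; rewrite /= !phiE e0 e1 e2 e3 !expr1 pDq pE qE.
  move=> /(jacobi_conjugation _ _ _ _ _ _ _ _ _ _ _ _ _ _ _ _ _ _ mu0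
    (attach 0) (attach 1) (attach 2) (attach 3)).
  rewrite !D0_mul => <-; rewrite (mulKmx uF) VmxT_col scalerA (mulVf r30) scale1r.
  rewrite -[phi (inl (inord 0))](attach 0) -[phi (inl (inord 7))](attach 1).
  apply/matrixP => i j; rewrite !mxE.
  case: i => -[|[|[|[|//]]]] i /=; rewrite ?addKr //.
    by rewrite -[phi _](attach 2) mulrDr addKr.
  by rewrite -[phi _](attach 3) mulrDr addKr.
(* Conversely, [w] solves the core system; undoing the scaling gives the core values, the cusp
   values are prescribed, and the result extends to the tree. *)
set w := invmx (FX mu) *m _ => dE.
have [y1 [y2 [y3 [y4 [y5 [y6 [y7 [y8 [y9 wE]]]]]]]]] := jacobi_scale_surj w.
pose y := [:: y1; y2; y3; y4; y5; y6; y7; y8; y9].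
pose phi (u : qvertex) : C :=
  match u with
  | inl i => y`_i
  | inr (j, n) => p ^+ n.+1 * b j 0 + q ^+ n.+1 * d j 0
  end.
have yE k : (k < 9)%N -> phi (inl (inord k)) = y`_k by move=> k9; rewrite /phi inordK.
have phiE j n : phi (inr (j, n)) = p ^+ n.+1 * b j 0 + q ^+ n.+1 * d j 0 by [].
clearbody phi.
have attach j : b j 0 + d j 0 = phi (inl (inord (attach_vertex j).-1)).
  move: dE; rewrite -wE VmxT_col scalerA (mulVf r30) scale1r /D0 !mul_diag_mx.
  move=> /(congr1 (fun v : 'cV[C]_4 => v j 0)); rewrite !mxE.
  case: j => -[|[|[|[|//]]]] i; rewrite /attach_vertex yE //= ?mul1r /sqrt3.
  - by move=> ->; rewrite addNKr.
  - by move=> ->; rewrite addNKr.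
  - by move=> e; apply: (mulfI r30); rewrite mulrDr e addNKr.
  - by move=> e; apply: (mulfI r30); rewrite mulrDr e addNKr.
have [f f_inv fE] := invariant_extension lift hlift _ phi.
have fphi : f \o lift = phi by apply/funext.
exists f; split=> [//||j n]; last by rewrite fE phiE cuspE.
apply/(eigenfunction_quotient _ hlift _ _ _ f_inv) => u; rewrite fphi fE -/p -/q.
case: u => [i|z]; last exact: (quotient_cusp_eigen phi _ _ b d pq phiE).2.
move: i; apply/quotient_core_eigen; rewrite /= !yE // !phiE pDq.
case: ord4 => -> -> -> ->; rewrite !expr1 pE qE.
have a0 := attach 0; have a1 := attach 1; have a2 := attach 2; have a3 := attach 3.
rewrite /attach_vertex !yE //= in a0 a1 a2 a3.
apply/(jacobi_conjugation _ _ _ _ _ _ _ _ _ _ _ _ _ _ _ _ _ _ mu0 a0 a1 a2 a3).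
by rewrite wE /w (mulKVmx uF) D0_mul.
Qed.

End Eigenfunctions.

(** The meromorphic identities are stated pointwise where [FX] is invertible; by the first clause
    this excludes only finitely many mu. *)
Theorem theorem5p5 (R : realType) (lift : qvertex -> set (set 'cV[KX]_2))
    (hlift : takahashi_domain lift) :
  [/\ exists E : seq R[i], forall mu : R[i], mu \notin E -> FX mu \in unitmx,
      forall mu : R[i], mu != 0 -> FX mu \in unitmx ->
        [/\ Delta mu != 0,
            SX mu = (Delta mu)^-1 *: mx_of_rows 4 4
              [:: [:: p_X mu / mu ^+ 2; beta0 mu; beta1 mu; beta1 mu];
                  [:: beta0 mu; p_X mu / mu ^+ 2; beta1 mu; beta1 mu];
                  [:: beta1 mu; beta1 mu; beta2 mu; p_X mu];
                  [:: beta1 mu; beta1 mu; p_X mu; beta2 mu]] &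
            \det (SX mu) =
              - (((3 * mu ^+ 2 - 1) * (mu ^+ 4 + 3)) /
                 (mu ^+ 4 * (mu ^+ 2 - 3) * (3 * mu ^+ 4 + 1)))],
      forall (s : R[i]) (M : 'M[R[i]]_4), FX (mu_of s) \in unitmx ->
        is_Saut lift s M <-> M = invmx (D0 R) *m SX (mu_of s) *m D0 R &
      forall (s : R[i]) (M : 'M[R[i]]_4), FX (mu_of s) \in unitmx ->
        c_out (mu_of s) != 0 ->
        is_Phi lift s M <->
        M = (c_in (mu_of s) / c_out (mu_of s)) *:
              (invmx (D0 R) *m SX (mu_of s) *m D0 R)].
Proof.
have uD0 := D0_unit R.
split.
- exact: FX_unitmx_cofinite.
- move=> mu muN0 uF.
  by split; [exact: Delta_neq0|exact: SXE|exact: det_SX].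
- move=> s M uF; split=> [MS|-> b b'].
    apply: col_ext => b.
    (* Testing [M] on its own output gives D_0 M b = S_X D_0 b for every b, which determines [M]. *)
    have /(generalized_eigenfunctionP _ _ hlift _ _ _ uF) := (MS b (M *m b)).2 erefl.
    by rewrite -!mulmxA => <-; rewrite mulKmx.
  rewrite generalized_eigenfunctionP // -!mulmxA.
  by split=> [<-|->]; rewrite ?mulKmx ?mulKVmx.
move=> s M uF; rewrite /is_Phi.
(* Since q^(s-1) = mu / sqrt 3 and q^s = sqrt 3 mu, the normalizing factors are [c_in] and
   [c_out]. *)
have -> : qpow (s - 1) - qpow (1 - s) = c_in (mu_of s) :> R[i].
  by rewrite -(opprB 1 s) qpowN qpow_muV invf_div.
have -> : qpow s - qpow (- s) = c_out (mu_of s) :> R[i].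
  by rewrite qpowN qpow_mu invfM [_^-1 * _]mulrC.
move: (c_in _) (c_out _) => p q q0.
have eig b d : (exists f, generalized_eigenfunction lift s (p *: b) (q *: d) f) <->
    d = (p / q) *: (invmx (D0 R) *m SX (mu_of s) *m D0 R) *m b.
  rewrite generalized_eigenfunctionP // -!scalemxAr -scalemxAl -!mulmxA.
  split=> [e|->]; last by rewrite -scalemxAr mulKVmx // scalerA mulrCA mulfV // mulr1.
  by rewrite mulrC -scalerA scalemxAr -e -scalemxAr mulKmx // scalerA mulVf // scale1r.
split=> [MS|-> //]; apply: col_ext => b.
by apply/eig/MS.
Qed.
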